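(* Let $(G,T)$ be a two-generated group of $GM(5)$-type, let $\eta=-\frac13$, and let $\mathbb{F}$ be a field of good characteristic relative to $(5,\eta)$. Then every idempotent in $T$ is a left axis of $\mathcal{M}(4/3,-4/3)$-type in the algebra $A_{\mathbb{F}}(G,T,\eta)$.
   Context: Groups. A pair $(G,T)$ is a faithful odd transposition group if $G$ is a periodic group, $T$ is a normal (conjugation-invariant) subset of involutions of $G$ with $\langle T\rangle=G$, and $|ab|$ is odd for any $a,b\in T$. It is of $GM(p)$-type if $|ab|=p$ for any two distinct $a,b\in T$. It is two-generated if $G=\langle a,b\rangle$ for some distinct $a,b\in T$ (so $G$ is dihedral of order $2p$ and $T=I(a,b)$). Write $a^b=b^{-1}ab$, and let $I(a,b)$ be the set of all involutions of $\langle a,b\rangle$. Algebra. Fields have characteristic not $2$; algebras are not assumed associative or commutative. $A_{\mathbb{F}}(G,T,\eta)$ (for $\eta\in\mathbb{F}\setminus\{0,1\}$) is the $\mathbb{F}$-algebra with basis $T$ and bilinear product $a*a=a$, and $a*b=b^a+\eta\sum_{x\in I(a,b)\setminus\{b^a\}}x$ for $a\ne b$ in $T$. The field $\mathbb{F}$ has good characteristic relative to $(p,\eta)$ if $1,\ \eta(p-2)+1,\ \eta-1,\ 1-\eta$ are distinct in $\mathbb{F}$. Axes. A fusion law is a finite set $\mathcal{F}\subseteq\mathbb{F}$ with a map $\circ:\mathcal{F}\times\mathcal{F}\to 2^{\mathcal{F}}$. For an idempotent $a$ let $L_a(x)=a*x$, $R_a(x)=x*a$, $A_\lambda(L_a)=\{v:a*v=\lambda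 v\}$ (similarly for $R_a$), and $A_\Omega(L_a)=\bigoplus_{\lambda\in\Omega}A_\lambda(L_a)$. The idempotent $a$ is primitive if $\dim A_1(L_a)=\dim A_1(R_a)=1$. A left $(\mathcal{F},\circ)$-axis is a primitive idempotent $a$ with $A=A_{\mathcal{F}}(L_a)$ (so $L_a$ is semisimple) such that $x*y\in A_{\alpha\circ\beta}(L_a)$ for all $\alpha,\beta\in\mathcal{F}$, $x\in A_\alpha(L_a)$, $y\in A_\beta(L_a)$. The Monster type fusion law $\mathcal{M}(\alpha,\beta)$ is the symmetric law on $\{1,0,\alpha,\beta\}$ given by $1\circ1=\{1\}$, $1\circ0=\varnothing$, $1\circ\alpha=\{\alpha\}$, $1\circ\beta=\{\beta\}$, $0\circ0=\{0\}$, $0\circ\alpha=\{\alpha\}$, $0\circ\beta=\{\beta\}$, $\alpha\circ\alpha=\{1,0\}$, $\alpha\circ\beta=\{\beta\}$, $\beta\circ\beta=\{1,0,\alpha\}$.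
   Formalization: The formal theorem also assumes that the field does not have characteristic 5: that characteristic is good relative to (5, -1/3), but there dim A_1(R_a) is at least 2, so the idempotents in T are not primitive and the claim fails. *)

(* Defs.v *)
From HB Require Import structures.
From mathcomp Require Import all_boot all_order all_algebra.
From mathcomp Require Import finmap.
From mathcomp Require Import boolp classical_sets functions cardinality fsbigop.
From mathcomp.multinomials Require Import monalg.

Set Implicit Arguments.
Unset Strict Implicit.
Unset Printing Implicit Defensive.

Import GRing.Theory.

Local Open Scope classical_set_scope.
Local Open Scope ring_scope.

Section Groups.
Local Open Scope group_scope.
Variable G : groupType.
Implicit Types (x y a b : G) (A H T : set G).

Definition has_order x n :=
  [/\ (0 < n)%N, x ^+ n = 1 & forall m, (0 < m < n)%N -> x ^+ m <> 1].

Definition periodic := forall x, exists2 n, (0 < n)%N & x ^+ n = 1.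

Definition involution x := has_order x 2.

Definition is_subgroup H :=
  [/\ H 1, forall x y, H x -> H y -> H (x * y) & forall x, H x -> H x^-1].

Definition generated A : set G := smallest is_subgroup A.

(* I(a, b) *)
Definition involutions_of a b : set G :=
  [set x | generated [set a; b] x /\ involution x].

Record odd_transposition_axioms T : Prop := OddTranspositionAxioms {
  ot_periodic : periodic;
  ot_involution : forall x, T x -> involution x;
  ot_conj : forall x y, T x -> T (x ^ y);
  ot_generated : generated T = setT;
  ot_odd : forall a b, T a -> T b -> exists2 n, odd n & has_order (a * b) n
}.

End Groups.

Record oddTranspositionGroup := OddTranspositionGroup {
  ot_group : groupType;
  ot_set : set ot_group;
  otP : odd_transposition_axioms ot_set
}.

Arguments ot_set : clear implicits.

Section OddTranspositionGroups.
Local Open Scope group_scope.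
Variable X : oddTranspositionGroup.
Implicit Types a b x : ot_set X.

Definition GM_type (p : nat) :=
  forall a b, a <> b -> has_order (val a * val b) p.

Definition two_generated :=
  exists a b, a <> b /\ generated [set val a; val b] = setT.

Lemma conjT_subproof (b a : ot_set X) : val b ^ val a \in ot_set X.
Proof. by apply/mem_set/(ot_conj (otP X))/set_mem/valP. Qed.

(* b ^ a, as an element of T *)
Definition conjT (b a : ot_set X) : ot_set X := SigSub (conjT_subproof b a).

(* I(a, b), as a set of elements of T; no involution is lost, since |ab| is odd
   and hence all the involutions of <a, b> are conjugate to a. *)
Definition involutionsT a b : set (ot_set X) :=
  [set x | involutions_of (val a) (val b) (val x)].

End OddTranspositionGroups.

Section Algebra.
Variables (X : oddTranspositionGroup) (F : fieldType) (eta : F).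
Local Notation A := {malg F[ot_set X]}.
Implicit Types (a b : ot_set X) (u v w : A).

Definition basis_mul a b : A :=
  if a == b then << a >>
  else << conjT b a >>
       + eta *: \sum_(x \in involutionsT a b `\ conjT b a) (<< x >> : A).

(* The product of A_F(G, T, eta) on the vector space with basis T. *)
Definition alg_mul u v : A :=
  \sum_(a <- msupp u) \sum_(b <- msupp v) (u@_a * v@_b) *: basis_mul a b.

Lemma alg_mulEw u v (D E : {fset ot_set X}) :
  (msupp u `<=` D)%fset -> (msupp v `<=` E)%fset ->
  alg_mul u v = \sum_(a <- D) \sum_(b <- E) (u@_a * v@_b) *: basis_mul a b.
Proof.
move=> uD vE; rewrite /alg_mul (big_fset_incl _ uD) /=; last first.
  move=> a _ /mcoeff_outdom ua; rewrite big1 // => b _.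
  by rewrite ua mul0r scale0r.
apply: eq_bigr => a _; apply: big_fset_incl => // b _ /mcoeff_outdom vb.
by rewrite vb mulr0 scale0r.
Qed.

Lemma alg_mul_bilinear : bilinear_for *:%R *:%R alg_mul.
Proof.
split=> [w c u v | w c u v] /=.
- set D := (msupp (c *: u + v) `|` (msupp u `|` msupp v))%fset.
  have uD : (msupp u `<=` D)%fset by rewrite fsubsetU // fsubsetUl orbT.
  have vD : (msupp v `<=` D)%fset by rewrite fsubsetU // fsubsetUr orbT.
  have wD : (msupp (c *: u + v) `<=` D)%fset by rewrite fsubsetUl.
  rewrite (alg_mulEw wD (fsubset_refl _)) (alg_mulEw uD (fsubset_refl _)).
  rewrite (alg_mulEw vD (fsubset_refl _)) scaler_sumr -big_split /=.
  apply: eq_bigr => a _; rewrite scaler_sumr -big_split /=.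
  apply: eq_bigr => b _.
  by rewrite mcoeffD mcoeffZ mulrDl scalerDl -mulrA scalerA.
- set D := (msupp (c *: u + v) `|` (msupp u `|` msupp v))%fset.
  have uD : (msupp u `<=` D)%fset by rewrite fsubsetU // fsubsetUl orbT.
  have vD : (msupp v `<=` D)%fset by rewrite fsubsetU // fsubsetUr orbT.
  have wD : (msupp (c *: u + v) `<=` D)%fset by rewrite fsubsetUl.
  rewrite (alg_mulEw (fsubset_refl _) wD) (alg_mulEw (fsubset_refl _) uD).
  rewrite (alg_mulEw (fsubset_refl _) vD) scaler_sumr -big_split /=.
  apply: eq_bigr => a _; rewrite scaler_sumr -big_split /=.
  apply: eq_bigr => b _.
  by rewrite mcoeffD mcoeffZ mulrDr scalerDl mulrCA scalerA.
Qed.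

HB.instance Definition _ :=
  bilinear_isBilinear.Build F A A A *:%R *:%R alg_mul alg_mul_bilinear.

End Algebra.

Definition good_char (F : fieldType) (p : nat) (eta : F) :=
  uniq [:: 1; eta * (p%:R - 2) + 1; eta - 1; 1 - eta].

Record fusionLaw (F : fieldType) := FusionLaw {
  fl_set : {fset F};
  fl_op : F -> F -> {fset F};
  fl_op_sub : forall alpha beta, alpha \in fl_set -> beta \in fl_set ->
    (fl_op alpha beta `<=` fl_set)%fset
}.

(* A (possibly nonassociative, noncommutative, nonunital) F-algebra is a left
   F-module A with a bilinear map mul : A -> A -> A. *)
Section Axes.
Variables (F : fieldType) (A : lmodType F).
Implicit Types (f : A -> A) (lambda : F) (Omega : {fset F}) (E : set A).

Definition eigenset f lambda : set A := [set v | f v = lambda *: v].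

(* The sum of the A_lambda(f), lambda in Omega; it is direct as f is linear. *)
Definition eigensum f Omega : set A :=
  [set v | exists2 w : F -> A,
     forall lambda, lambda \in Omega -> eigenset f lambda (w lambda) &
     v = \sum_(lambda <- Omega) w lambda].

Definition has_dim E n :=
  exists2 e : 'I_n -> A, forall i, E (e i) &
    forall v, E v -> exists! c : 'rV[F]_n, v = \sum_i c 0 i *: e i.

Variable mul : {bilinear A -> A -> A}.

Definition primitive a :=
  has_dim (eigenset (mul a) 1) 1 /\ has_dim (eigenset (mul^~ a) 1) 1.

Definition left_axis (law : fusionLaw F) (a : A) :=
  [/\ mul a a = a,
      primitive a,
      eigensum (mul a) (fl_set law) = setT &
      forall alpha beta x y,
        alpha \in fl_set law -> beta \in fl_set law ->
        eigenset (mul a) alpha x -> eigenset (mul a) beta y ->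
        eigensum (mul a) (fl_op law alpha beta) (mul x y)].

End Axes.

Section MonsterLaw.
Variables (F : fieldType) (alpha beta : F).

Definition monster_set : {fset F} := [fset 1; 0; alpha; beta]%fset.

(* Only meant for distinct 1, 0, alpha, beta, and for x, y in monster_set. *)
Definition monster_op (x y : F) : {fset F} :=
  (if x == 1 then if y == 0 then fset0 else [fset y]
   else if y == 1 then if x == 0 then fset0 else [fset x]
   else if x == 0 then [fset y]
   else if y == 0 then [fset x]
   else if (x == alpha) && (y == alpha) then [fset 1; 0]
   else if (x == beta) && (y == beta) then [fset 1; 0; alpha]
   else [fset beta])%fset.

Lemma monster_op_sub x y : x \in monster_set -> y \in monster_set ->
  (monster_op x y `<=` monster_set)%fset.
Proof.
move=> xM yM; rewrite /monster_op.
by repeat case: ifP => _; apply/fsubsetP => z; rewrite ?inE //;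
  do ?[case/orP]; move/eqP=> -> //; rewrite ?eqxx ?orbT //;
  move: xM yM; rewrite !inE.
Qed.

Definition monster_law := FusionLaw monster_op_sub.

End MonsterLaw.

(* Main.v *)
Require Import Defs.
From HB Require Import structures.
From mathcomp Require Import all_boot all_order all_algebra.
From mathcomp Require Import finmap.
From mathcomp Require Import boolp classical_sets functions cardinality fsbigop.
From mathcomp.multinomials Require Import monalg.
From mathcomp Require Import ring.

(** Why the theorem holds.  The group is dihedral of order 10, so T is a regular
pentagon: it can be labelled by 'F_5, with the given involution t at 0, so that
conjugation is f i ^ f j = f (2 j - i) and any two distinct elements generate
everything (pentagon_labelling).  Write S for the sum of all of T.  Then, for
i <> j,
  f i * f j = (1 - eta) f (2 i - j) + eta S,
and every unit u of F_5 acts on the algebra by the automorphism f i |-> f (u i)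
fixing t (dil_eigen_mul).  The theorem is a reflection of this symmetry: the
units form a cyclic group of order 4 generated by 2, and since 2 ^ 2 = - 1, the
algebra decomposes under it, with alpha = 1 - eta = 4 / 3, as follows.

- The vectors fixed by 2 are spanned by t and S - eta t.  The relation
  1 + 3 eta = 0 says exactly that S acts as the scalar eta on both sides
  (ones_mul, mul_ones), whence t (S - eta t) = (S - eta t) t = 0 and
  (S - eta t) (S - eta t) = eta (S - eta t).  These are the eigenspaces for 1
  and 0.
- The vectors negated by 2, which form a line, are fixed by - 1 and have
  coefficient sum 0; left multiplication by t is f k |-> (1 - eta) f (- k) on
  them, which gives the eigenvalue alpha.
- The vectors negated by - 1 are, by the same formula, those with eigenvalue
  - alpha.

The fusion law is then read off from the symmetry (axis_fusion).  A product is
fixed or negated by - 1 according to the signs of its factors, which settles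
all the cases involving - alpha; on vectors fixed by - 1, the sign under 2
settles those involving alpha; the remaining ones are the three products above.
The good characteristic makes the four eigenvalues distinct, so that every
eigenvector lies in the expected component.  Primitivity on the right
(right_eigenset_one) is different: right multiplication by t is
f k |-> alpha f (2 k) up to multiples of S and t, so a further fixed vector
would need alpha ^ 4 = 1, and alpha ^ 4 - 1 = 5 ^ 2 * 7 / 3 ^ 4 is nonzero. *)

Set Implicit Arguments.
Unset Strict Implicit.
Unset Printing Implicit Defensive.

Import GRing.Theory.
Local Open Scope ring_scope.

(** * The involutions of a dihedral group of order 10 *)

Section Dihedral.
Local Open Scope group_scope.
Variables (G : groupType) (a b : G).
Hypotheses (a_inv : involution a) (b_inv : involution b).
Hypothesis ab_order : has_order (a * b) 5.
Implicit Types i j k : 'F_5.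

Definition rotation i : G := (a * b) ^+ i.
Definition reflection i : G := a * rotation i.

Lemma involution_mulgg {x : G} : involution x -> x * x = 1.
Proof. by case=> _ + _; rewrite expg2. Qed.

Lemma rotation0 : rotation 0 = 1. Proof. exact: expg0. Qed.

Lemma rotationD i j : rotation (i + j)%R = rotation i * rotation j.
Proof.
rewrite /rotation -expgnDr /= [in RHS](divn_eq (i + j) 5) expgnDr mulnC expgnA.
by case: ab_order => _ -> _; rewrite expg1n mul1g.
Qed.

Lemma rotationN i : rotation (- i)%R = (rotation i)^-1.
Proof. by apply/esym/mulg1_eq; rewrite -rotationD subrr rotation0. Qed.

Lemma rotation_eq1 i : rotation i = 1 -> i = 0%R.
Proof.
move=> ri; apply/val_inj/eqP/negPn/negP; rewrite -lt0n => i_gt0.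
by case: ab_order => _ _ /(_ i); apply=> //; rewrite i_gt0 (ltn_ord i).
Qed.

Lemma rotationX i j : rotation i ^+ j = rotation (i * j)%R.
Proof.
rewrite -[in RHS](natr_Zp j) mulr_natr; elim: (j : nat) => [|n IHn].
  by rewrite expg0 mulr0n rotation0.
by rewrite expgS mulrS rotationD IHn.
Qed.

Lemma rotation_mula i : rotation i * a = a * rotation (- i)%R.
Proof.
have ba : b * a = (a * b)^-1.
  apply/esym/mulg1_eq; rewrite -mulgA (mulgA b) (involution_mulgg b_inv).
  by rewrite mul1g (involution_mulgg a_inv).
rewrite rotationN /rotation; elim: (i : nat) => [|n IHn].
  by rewrite expg0 invg1 mulg1 mul1g.
by rewrite expgS -mulgA IHn mulgA -(mulgA a) ba -mulgA -invgM -expgSr -expgS.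
Qed.

Lemma reflection_mulg i j : reflection i * reflection j = rotation (j - i)%R.
Proof.
rewrite /reflection mulgA -(mulgA a) rotation_mula mulgA.
by rewrite (involution_mulgg a_inv) mul1g -rotationD addrC.
Qed.

Lemma reflectionV i : (reflection i)^-1 = reflection i.
Proof. by apply: mulg1_eq; rewrite reflection_mulg subrr rotation0. Qed.

Lemma reflection_mul_rot i j : reflection i * rotation j = reflection (i + j)%R.
Proof. by rewrite /reflection -mulgA -rotationD. Qed.

Lemma reflection_conj i j :
  reflection i ^ reflection j = reflection (2%:R * j - i)%R.
Proof.
rewrite conjgE reflectionV reflection_mulg reflection_mul_rot.
congr (reflection _).
by rewrite mulr2n mulrDl !mul1r addrA.
Qed.

Lemma reflection_inj : injective reflection.
Proof.
move=> i j eq_ij; apply/esym/subr0_eq/rotation_eq1.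
by rewrite -reflection_mulg eq_ij reflection_mulg subrr rotation0.
Qed.

(** The rotations and reflections form a subgroup containing the generators. *)
Lemma generated_dihedral (x : G) : generated [set a; b]%classic x ->
  exists i, x = rotation i \/ x = reflection i.
Proof.
move=> gen_x.
apply: (gen_x [set x | exists i, x = rotation i \/ x = reflection i]%classic).
split; [split|].
- by exists 0%R; left; rewrite rotation0.
- move=> _ _ [i [->|->]] [j [->|->]].
  + by exists (i + j)%R; left; rewrite rotationD.
  + exists (j - i)%R; right.
    by rewrite /reflection mulgA rotation_mula -mulgA -rotationD addrC.
  + by exists (i + j)%R; right; rewrite reflection_mul_rot.
  + by exists (j - i)%R; left; rewrite reflection_mulg.
- move=> _ [i [->|->]].
  + by exists (- i)%R; left; rewrite rotationN.
  + by exists i; right; rewrite reflectionV.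
- move=> _ [->|->].
  + by exists 0%R; right; rewrite /reflection rotation0 mulg1.
  + exists 1%R; right.
    by rewrite /reflection /rotation expg1 mulgA (involution_mulgg a_inv) mul1g.
Qed.

(** A rotation has odd order, hence is never an involution. *)
Lemma involution_reflection (x : G) : generated [set a; b]%classic x ->
  involution x -> exists i, x = reflection i.
Proof.
move=> /generated_dihedral[i [->|->]] [_ ri2 /(_ 1%N isT)]; last by exists i.
rewrite expg1 => ri_neq1; case: ri_neq1.
have /eqP := rotation_eq1 (etrans (rotationD i i) ri2).
by rewrite -mulr2n -mulr_natr mulf_eq0 => /orP[/eqP->|//]; rewrite rotation0.
Qed.

(** The product of two distinct reflections is a nontrivial rotation, which
generates all the rotations because 5 is prime. *)
Lemma generated_reflection i j k : i != j ->
  generated [set reflection i; reflection j]%classic (reflection k).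
Proof.
move=> neq_ij H [[H1 HM _] sub].
have HX x n : H x -> H (x ^+ n).
  by move=> Hx; elim: n => [|n IHn]; rewrite ?expg0 // expgS; exact: HM.
have -> : k = (i + (j - i) * ((k - i) / (j - i)))%R.
  by rewrite mulrC divfK ?subrKC // subr_eq0 eq_sym.
rewrite -reflection_mul_rot -rotationX -reflection_mulg.
apply: (HM); first by apply: sub; left.
by apply/HX/HM; apply: sub; [left|right].
Qed.

End Dihedral.

(** T is the set of reflections: it contains them all, being closed under
conjugation, and nothing else by involution_reflection.  The labelling is
shifted so as to start at t. *)
Lemma pentagon_labelling (X : oddTranspositionGroup) (t : ot_set X) :
    two_generated X -> GM_type X 5 ->
  exists f : 'F_5 -> ot_set X,
    [/\ f 0 = t, bijective f,
        forall i j, conjT (f i) (f j) = f (2%:R * j - i)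
      & forall i j, i != j -> involutionsT (f i) (f j) = setT].
Proof.
move=> [a [b [neq_ab gen_ab]]] GM5.
have valT (x : ot_set X) : ot_set X (val x) by apply/set_mem/valP.
have inv (x : ot_set X) : involution (val x).
  exact: ot_involution (otP X) _ (valT x).
have ab_order : has_order (val a * val b)%g 5 by exact: GM5.
pose r := reflection (val a) (val b).
have rT i : r i \in ot_set X.
  (* conjugating a = r 0 by r j gives r (2 j), and 2 is invertible mod 5 *)
  rewrite (_ : r i = val a ^ r (i / 2%:R)%R)%g.
    exact/mem_set/(ot_conj (otP X)).
  have -> : val a = r 0 by rewrite /r /reflection rotation0 ?mulg1.
  by rewrite reflection_conj //; congr r; rewrite subr0 mulrC divfK.
have rS (x : ot_set X) : exists i, val x = r i.
  by apply: involution_reflection (inv x) => //; rewrite gen_ab.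
have [m tm] := rS t.
pose f i : ot_set X := SigSub (rT (m + i)).
have f_inj : injective f.
  by move=> i j /(congr1 val) /= /reflection_inj /addrI; apply.
have f_surj x : exists i, f i = x.
  have [i xi] := rS x; exists (i - m); apply: val_inj => /=.
  by rewrite xi addrC subrK.
exists f; split.
- by apply: val_inj; rewrite /= addr0.
- have [g gK] := choice f_surj; exists g => // i; exact: f_inj.
- move=> i j; apply: val_inj; rewrite /= reflection_conj //; congr r; ring.
- move=> i j neq_ij; apply/seteqP; split=> // x _; split; last exact: inv.
  have [k ->] := rS x; apply: generated_reflection => //.
  by rewrite (inj_eq (addrI m)).
Qed.

(** * Sums of eigenspaces *)

Section Eigensums.
Variables (F : fieldType) (A : lmodType F).
Variables (mul : {bilinear A -> A -> A}) (a : A).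
Implicit Types (Omega : {fset F}) (lambda : F).

Lemma eigensetZ lambda c v :
  eigenset (mul a) lambda v -> eigenset (mul a) lambda (c *: v).
Proof.
by rewrite /eigenset /= => av; rewrite linearZr_LR /= av !scalerA mulrC.
Qed.

Lemma eigensum_eigenset Omega lambda v :
  lambda \in Omega -> eigenset (mul a) lambda v -> eigensum (mul a) Omega v.
Proof.
move=> lO av; exists (fun mu => if mu == lambda then v else 0).
  by move=> mu _; case: eqP => [->|_] //; rewrite /eigenset /= linear0r scaler0.
rewrite (big_fsetD1 lambda lO) /= eqxx big1_fset ?addr0 // => mu.
by rewrite !inE => /andP[/negPf->].
Qed.

Lemma eigensumD Omega u v :
  eigensum (mul a) Omega u -> eigensum (mul a) Omega v ->
  eigensum (mul a) Omega (u + v).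
Proof.
move=> [wu wuP ->] [wv wvP ->]; exists (wu \+ wv); last by rewrite big_split.
move=> mu muO; rewrite /eigenset /= linearDr scalerDr.
by rewrite (wuP _ muO) (wvP _ muO).
Qed.

Lemma eigensum0 Omega : eigensum (mul a) Omega 0.
Proof.
exists (fun=> 0) => [mu _|]; last by rewrite big1.
by rewrite /eigenset /= linear0r scaler0.
Qed.

Lemma eigensum_sub Omega Omega' v : (Omega `<=` Omega')%fset ->
  eigensum (mul a) Omega v -> eigensum (mul a) Omega' v.
Proof.
move=> /fsubsetP sub [w wP ->]; rewrite big_seq_cond.
apply: (big_ind (eigensum (mul a) Omega')).
- exact: eigensum0.
- exact: eigensumD.
- move=> mu /andP[muO _].
  exact: eigensum_eigenset (sub _ muO) (wP _ muO).
Qed.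

End Eigensums.

Lemma has_dim1 (F : fieldType) (A : lmodType F) (E : set A) (e : A) :
    e != 0 -> E e -> (forall v, E v -> exists c : F, v = c *: e) ->
  has_dim E 1.
Proof.
move=> e0 Ee span; exists (fun=> e) => // v /span[c ->].
exists (const_mx c); split=> [|d]; first by rewrite big_ord1 mxE.
rewrite big_ord1 => /eqP; rewrite -subr_eq0 -scalerBl scaler_eq0 (negPf e0).
rewrite orbF subr_eq0 => /eqP cd; apply/rowP => i.
by rewrite mxE cd (ord1 i).
Qed.

Lemma alg_mulU (X : oddTranspositionGroup) (F : fieldType) (eta : F)
    (s t : ot_set X) :
  alg_mul eta << s >> << t >> = basis_mul eta s t.
Proof.
by rewrite /alg_mul !msuppU !oner_eq0 !big_seq_fset1 !mcoeffUU mulr1 scale1r.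
Qed.

(** * The product in coordinates *)

Section Pentagon.
Variables (X : oddTranspositionGroup) (F : fieldType) (eta : F).
Variable f : 'F_5 -> ot_set X.
Hypothesis f_bij : bijective f.
Hypothesis f_conj : forall i j, conjT (f i) (f j) = f (2%:R * j - i).
Hypothesis f_inv : forall i j, i != j -> involutionsT (f i) (f j) = setT.
Local Notation A := {malg F[ot_set X]}.
Implicit Types (i j k : 'F_5) (x y : A).

Lemma sum_delta (g : 'F_5 -> F) k : \sum_i g i * (i == k)%:R = g k.
Proof.
rewrite (bigD1 k) //= eqxx mulr1 big1 ?addr0 // => i /negPf->.
by rewrite mulr0.
Qed.

Definition vec (c : 'F_5 -> F) : A := \sum_i c i *: << f i >>.

Lemma coordU i k : (<< f i >> : A)@_(f k) = (i == k)%:R.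
Proof. by rewrite mcoeffU (bij_eq f_bij). Qed.

Lemma coordP x y : (forall i, x@_(f i) = y@_(f i)) -> x = y.
Proof.
by case: f_bij => g _ gK xy; apply/malgP => t; rewrite -(gK t) xy.
Qed.

Lemma coord_vec c k : (vec c)@_(f k) = c k.
Proof.
rewrite /vec (raddf_sum (mcoeff (f k))) -[RHS]sum_delta.
by apply: eq_bigr => i _ /=; rewrite mcoeffZ coordU.
Qed.

Lemma vec_coord x : x = vec (fun i => x@_(f i)).
Proof. by apply: coordP => k; rewrite coord_vec. Qed.

Definition ones : A := vec (fun=> 1).

Lemma sum_involutions i j : i != j ->
  \sum_(x \in involutionsT (f i) (f j) `\ conjT (f j) (f i)) (<< x >> : A)
    = ones - << f (2%:R * i - j) >>.
Proof.
move=> neq_ij; rewrite f_inv // f_conj; set c := f _.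
have onesE : \sum_(x \in [set: ot_set X]) (<< x >> : A) = ones.
  rewrite (reindex_fsbigT f) // /ones /vec.
  have -> : [set: 'F_5]%classic = [set` enum 'F_5]%classic.
    by apply/seteqP; split=> // k _ /=; rewrite mem_enum.
  rewrite -fsbig_seq ?enum_uniq // big_enum.
  by apply: eq_bigr => k _; rewrite scale1r.
rewrite -onesE [in RHS](fsbigD1 c) //=.
  by rewrite [X in _ = X - _]addrC addrK.
have -> : [set: ot_set X]%classic = (f @` [set: 'F_5])%classic.
  by case: f_bij => g _ gK; apply/seteqP; split=> // x _; exists (g x).
exact/finite_image/finite_finset.
Qed.

(** The last term corrects the generic formula on the diagonal, where the
product is << f i >> instead of (1 - eta) << f i >> + eta ones. *)
Lemma coord_basis_mul i j k : (basis_mul eta (f i) (f j) : A)@_(f k) =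
  eta + (1 - eta) * (2%:R * i - j == k)%:R
  + eta * (i == j)%:R * ((i == k)%:R - 1).
Proof.
rewrite /basis_mul (bij_eq f_bij); case: eqP => [->|/eqP neq_ij].
  have -> : 2%:R * j - j = j by ring.
  rewrite coordU ?eqxx mulr1n; ring.
rewrite sum_involutions // f_conj mcoeffD mcoeffZ mcoeffB coord_vec !coordU.
rewrite ?(negPf neq_ij) mulr0n; ring.
Qed.

Lemma coord_alg_mul x y k : (alg_mul eta x y)@_(f k) =
  eta * ((\sum_i x@_(f i)) * (\sum_i y@_(f i)) - \sum_i x@_(f i) * y@_(f i))
  + (1 - eta) * (\sum_i x@_(f i) * y@_(f (2%:R * i - k)))
  + eta * (x@_(f k) * y@_(f k)).
Proof.
have -> : alg_mul eta x y =
    \sum_i \sum_j (x@_(f i) * y@_(f j)) *: basis_mul eta (f i) (f j).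
  rewrite {1}(vec_coord x) {1}(vec_coord y) /vec linear_sumlz.
  apply: eq_bigr => i _; rewrite linear_sumr; apply: eq_bigr => j _.
  by rewrite linearZl_LR linearZ_LR /= scalerA alg_mulU.
have inner i :
    (\sum_j (x@_(f i) * y@_(f j)) *: basis_mul eta (f i) (f j))@_(f k) =
      (eta * \sum_j y@_(f j)) * x@_(f i)
      + (1 - eta) * (x@_(f i) * y@_(f (2%:R * i - k)))
      - eta * (x@_(f i) * y@_(f i))
      + eta * (x@_(f i) * y@_(f i)) * (i == k)%:R.
  rewrite (raddf_sum (mcoeff (f k))).
  rewrite (eq_bigr (fun j => (eta * x@_(f i)) * y@_(f j)
     + ((1 - eta) * x@_(f i) * y@_(f j) * (j == 2%:R * i - k)%:R
     + (eta * (x@_(f i) * y@_(f j)) * ((i == k)%:R - 1)) * (j == i)%:R))).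
    by rewrite !big_split /= !sum_delta -mulr_sumr; ring.
  move=> j _ /=; rewrite mcoeffZ coord_basis_mul.
  rewrite (_ : (2%:R * i - j == k) = (j == 2%:R * i - k)); last first.
    by rewrite [in RHS]eq_sym !subr_eq addrC.
  by rewrite (eq_sym i j); ring.
rewrite (raddf_sum (mcoeff (f k))) (eq_bigr _ (fun i _ => inner i)) /=.
rewrite !big_split /= sum_delta sumrN -!mulr_sumr; ring.
Qed.

(** * The action of the units of F_5 *)

(** The dilation f i |-> f (u i) is never built as a map: only its eigenvectors
matter, and they are described on coordinates. *)
Definition dil_eigen (u : 'F_5) (eps : F) x :=
  forall i, x@_(f (u * i)) = eps * x@_(f i).

Lemma sum_dilate (u : 'F_5) (g : 'F_5 -> F) :
  u != 0 -> \sum_i g (u * i) = \sum_i g i.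
Proof. by move=> u0; rewrite [RHS](reindex_inj (mulfI u0)). Qed.

(** Dilations by units are algebra automorphisms: they permute the summation
indices in coord_alg_mul, which only involves linear expressions in labels. *)
Lemma dil_eigen_mul u eps del x y : u != 0 ->
  dil_eigen u eps x -> dil_eigen u del y ->
  dil_eigen u (eps * del) (alg_mul eta x y).
Proof.
move=> u0 xu yu k; rewrite !coord_alg_mul.
have Sx : \sum_i x@_(f i) = eps * \sum_i x@_(f i).
  rewrite -[LHS](sum_dilate _ u0) mulr_sumr.
  by apply: eq_bigr => i _; apply: xu.
have Sy : \sum_i y@_(f i) = del * \sum_i y@_(f i).
  rewrite -[LHS](sum_dilate _ u0) mulr_sumr.
  by apply: eq_bigr => i _; apply: yu.
have Sxy : (\sum_i x@_(f i)) * (\sum_i y@_(f i)) =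
    eps * del * ((\sum_i x@_(f i)) * (\sum_i y@_(f i))).
  by rewrite mulrACA -Sx -Sy.
have Sd : \sum_i x@_(f i) * y@_(f i)
    = eps * del * \sum_i x@_(f i) * y@_(f i).
  rewrite -[LHS](sum_dilate _ u0) mulr_sumr.
  by apply: eq_bigr => i _; rewrite xu yu mulrACA.
have Sr : \sum_i x@_(f i) * y@_(f (2%:R * i - u * k))
    = eps * del * \sum_i x@_(f i) * y@_(f (2%:R * i - k)).
  rewrite -[LHS](sum_dilate _ u0) mulr_sumr; apply: eq_bigr => i _.
  by rewrite xu mulrCA -mulrBr yu mulrACA.
rewrite {1}Sxy {1}Sd Sr xu yu; ring.
Qed.

Lemma sum_coordU (g : 'F_5 -> F) k :
  \sum_i (<< f k >> : A)@_(f i) * g i = g k.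
Proof.
rewrite -[RHS]sum_delta; apply: eq_bigr => i _.
by rewrite coordU eq_sym mulrC.
Qed.

Lemma sum_coordU1 k : \sum_i (<< f k >> : A)@_(f i) = 1.
Proof.
rewrite -[RHS](sum_coordU (fun=> 1) k).
by apply: eq_bigr => i _; rewrite mulr1.
Qed.

Lemma coord_axis_mul y k : (alg_mul eta << f 0 >> y)@_(f k) =
  eta * (\sum_i y@_(f i) - y@_(f 0)) + (1 - eta) * y@_(f (- k))
  + eta * ((k == 0)%:R * y@_(f 0)).
Proof.
rewrite coord_alg_mul sum_coordU1 !sum_coordU mulr0 sub0r coordU eq_sym mul1r.
by case: eqP => [->|_]; rewrite ?mul0r.
Qed.

Lemma coord_mul_axis y k : (alg_mul eta y << f 0 >>)@_(f (2%:R * k)) =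
  eta * (\sum_i y@_(f i) - y@_(f 0)) + (1 - eta) * y@_(f k)
  + eta * ((k == 0)%:R * y@_(f 0)).
Proof.
rewrite coord_alg_mul sum_coordU1 mulr1.
have -> : \sum_i y@_(f i) * (<< f 0 >> : A)@_(f i) = y@_(f 0).
  rewrite -[RHS](sum_coordU (fun i => y@_(f i))).
  by apply: eq_bigr => i _; rewrite mulrC.
have -> : \sum_i y@_(f i) * (<< f 0 >> : A)@_(f (2%:R * i - 2%:R * k))
    = y@_(f k).
  rewrite -[RHS](sum_delta (fun i => y@_(f i))); apply: eq_bigr => i _.
  rewrite coordU -mulrBr eq_sym.
  by rewrite mulf_eq0 subr_eq0.
rewrite coordU eq_sym mulf_eq0 /=.
congr (_ + eta * _); case: eqP => [->|_]; first by rewrite mulr0 mulrC.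
by rewrite mulr0n mulr0 mul0r.
Qed.

(** * The eigenspaces of the axis *)

Section Axis.
Hypothesis eta3 : 1 + 3%:R * eta = 0.
Hypothesis two_neq0 : 2%:R != 0 :> F.
Local Notation alpha := (1 - eta).
Hypothesis good_eigenvalues : uniq [:: 1; 0; alpha; - alpha].
Local Notation axis := (<< f 0 >> : A).
Local Notation L := (alg_mul eta axis).
Local Notation tail y := (\sum_i y@_(f i) - y@_(f 0)).

(** As 2 is a primitive root mod 5, the labels on the right are all the nonzero
residues. *)
Lemma tailE y k : k != 0 ->
  tail y = y@_(f k) + y@_(f (2%:R * k)) + y@_(f (- k)) + y@_(f (2%:R * - k)).
Proof.
move=> k0; rewrite (bigD1 0) // addrC addKr.
have orbit_uniq : uniq [:: k; 2%:R * k; - k; 2%:R * - k].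
  by case: k k0 => [[|[|[|[|[|n]]]]] ltn].
have orbit_full i : (i != 0) = (i \in [:: k; 2%:R * k; - k; 2%:R * - k]).
  case: k k0 {orbit_uniq} => [[|[|[|[|[|n]]]]] ltn] // _;
  by case: i => [[|[|[|[|[|m]]]]] ltm].
rewrite (eq_bigl _ _ orbit_full) -big_uniq //= !big_cons big_nil /=; ring.
Qed.

Lemma dil_eigen_sqr eps x :
  dil_eigen 2%:R eps x -> dil_eigen (- 1) (eps * eps) x.
Proof.
move=> x2 i; have -> : - 1 = 2%:R * 2%:R :> 'F_5 by apply/val_inj.
by rewrite -mulrA !x2 mulrA.
Qed.

(** In coordinates, ones * y is (1 + 3 eta) (sum of the coordinates of y) ones
+ eta y. *)
Lemma ones_mul y : alg_mul eta ones y = eta *: y.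
Proof.
apply: coordP => k; rewrite coord_alg_mul mcoeffZ.
have onesE i : ones@_(f i) = 1 by rewrite coord_vec.
have -> : \sum_i ones@_(f i) = 5%:R.
  by rewrite (eq_bigr (fun=> 1)) // sumr_const card_Fp.
have sumE (g : 'F_5 -> 'F_5) :
    \sum_i ones@_(f i) * y@_(f (g i)) = \sum_i y@_(f (g i)).
  by apply: eq_bigr => i _; rewrite onesE mul1r.
rewrite (sumE id) (sumE (fun i => 2%:R * i - k)) onesE.
have -> : \sum_i y@_(f (2%:R * i - k)) = \sum_i y@_(f i).
  rewrite (sum_dilate (fun i => y@_(f (i - k)))) //.
  by rewrite [RHS](reindex_inj (addIr (- k))).
transitivity ((1 + 3%:R * eta) * (\sum_i y@_(f i)) + eta * y@_(f k)).
  by ring.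
by rewrite eta3 mul0r add0r.
Qed.

Lemma mul_ones y : alg_mul eta y ones = eta *: y.
Proof.
apply: coordP => k; rewrite coord_alg_mul mcoeffZ.
have onesE i : ones@_(f i) = 1 by rewrite coord_vec.
have -> : \sum_i ones@_(f i) = 5%:R.
  by rewrite (eq_bigr (fun=> 1)) // sumr_const card_Fp.
have sumE (g : 'F_5 -> 'F_5) :
    \sum_i y@_(f i) * ones@_(f (g i)) = \sum_i y@_(f i).
  by apply: eq_bigr => i _; rewrite onesE mulr1.
rewrite (sumE id) (sumE (fun i => 2%:R * i - k)) onesE.
transitivity ((1 + 3%:R * eta) * (\sum_i y@_(f i)) + eta * y@_(f k)).
  by ring.
by rewrite eta3 mul0r add0r.
Qed.

Lemma alpha_neq0 : alpha != 0.
Proof.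
move: good_eigenvalues; rewrite /= !inE !negb_or (eq_sym 0 alpha).
by case/and3P=> _ /andP[].
Qed.

Lemma eta_neq0 : eta != 0.
Proof.
move: good_eigenvalues; rewrite /= !inE !negb_or => /andP[/and3P[_ + _] _].
by apply: contra => /eqP->; rewrite subr0.
Qed.

Lemma alpha_neqN1 : 1 + alpha != 0.
Proof.
move: good_eigenvalues; rewrite /= !inE !negb_or => /andP[/and3P[_ _ +] _].
by rewrite -subr_eq0 opprK.
Qed.

Lemma alpha_neq1 : alpha != 1.
Proof. by rewrite -subr_eq0 addrAC subrr sub0r oppr_eq0 eta_neq0. Qed.

Lemma Nalpha_neq1 : - alpha != 1.
Proof. by rewrite -subr_eq0 -opprD oppr_eq0 addrC alpha_neqN1. Qed.

(** The 0-eigenvector: ones acts on axis as eta, so subtracting eta axis makes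
the product with axis vanish on both sides. *)
Definition axis0 : A := ones - eta *: axis.

Lemma coord_axis0 k : axis0@_(f k) = 1 - eta * (k == 0)%:R.
Proof. by rewrite mcoeffB mcoeffZ coord_vec coordU eq_sym. Qed.

Lemma dil_eigen_axis u : u != 0 -> dil_eigen u 1 axis.
Proof.
by move=> u0 i; rewrite !coordU !(eq_sym 0) mulf_eq0 (negPf u0) mul1r.
Qed.

Lemma dil_eigen_axis0 u : u != 0 -> dil_eigen u 1 axis0.
Proof. by move=> u0 i; rewrite !coord_axis0 mulf_eq0 (negPf u0) mul1r. Qed.

Lemma dil_eigenZ u eps c x : dil_eigen u eps x -> dil_eigen u eps (c *: x).
Proof. by move=> xu i; rewrite !mcoeffZ xu mulrCA. Qed.

Lemma axis_mul_axis : alg_mul eta axis axis = axis.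
Proof. by rewrite alg_mulU /basis_mul eqxx. Qed.

Lemma axis_mul_axis0 : alg_mul eta axis axis0 = 0.
Proof.
by rewrite /axis0 linearBr linearZ_LR /= mul_ones axis_mul_axis subrr.
Qed.

Lemma eigenset_axis : eigenset L 1 axis.
Proof. by rewrite /eigenset /= axis_mul_axis scale1r. Qed.

Lemma eigenset_axis0 : eigenset L 0 axis0.
Proof. by rewrite /eigenset /= axis_mul_axis0 scale0r. Qed.

Lemma axis0_mul_axis : alg_mul eta axis0 axis = 0.
Proof.
by rewrite /axis0 linearBl linearZl_LR /= ones_mul axis_mul_axis subrr.
Qed.

Lemma axis0_mul_axis0 : alg_mul eta axis0 axis0 = eta *: axis0.
Proof.
rewrite {1}/axis0 linearBl linearZl_LR /= ones_mul axis_mul_axis0.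
by rewrite scaler0 subr0.
Qed.

(** Coordinate 0 and the sum of the coordinates are dilation-invariant, so on a
negated vector they equal their opposites. *)
Lemma dil_eigen_opp_sum0 u y : u != 0 -> dil_eigen u (- 1) y ->
  y@_(f 0) = 0 /\ \sum_i y@_(f i) = 0.
Proof.
move=> u0 yu; have eq_opp (c : F) : c = - c -> c = 0.
  move/eqP; rewrite -subr_eq0 opprK -mulr2n -mulr_natr mulf_eq0.
  by rewrite (negPf two_neq0) orbF => /eqP.
split; apply: eq_opp; first by rewrite -{1}(mulr0 u) yu mulN1r.
rewrite -{1}(sum_dilate _ u0) -sumrN.
by apply: eq_bigr => i _; rewrite yu mulN1r.
Qed.

Lemma dil_eigenset_beta y : dil_eigen (- 1) (- 1) y ->
  eigenset L (- alpha) y.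
Proof.
move=> yN; have [//|y0 Sy] := dil_eigen_opp_sum0 _ yN.
apply: coordP => k; rewrite coord_axis_mul mcoeffZ Sy y0 -[- k]mulN1r yN; ring.
Qed.

Lemma dil_eigenset_alpha y : dil_eigen 2%:R (- 1) y ->
  eigenset L alpha y.
Proof.
move=> y2; have yN := dil_eigen_sqr y2; rewrite mulrNN mulr1 in yN.
have [//|y0 Sy] := dil_eigen_opp_sum0 _ y2.
apply: coordP => k; rewrite coord_axis_mul mcoeffZ Sy y0 -[- k]mulN1r yN; ring.
Qed.

Lemma dil2_eigensum y : dil_eigen 2%:R 1 y ->
  eigensum L [fset 1; 0]%fset y.
Proof.
move=> y2; have yk k : k != 0 -> y@_(f k) = y@_(f 1).
  have y1 j : y@_(f (2%:R * j)) = y@_(f j) by rewrite y2 mul1r.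
  (* the nonzero residues mod 5 are the powers of 2 *)
  have y_pow n : y@_(f (iter n ( *%R 2%:R) 1)) = y@_(f 1).
    by elim: n => //= n IHn; rewrite y1.
  case: k => [[|[|[|[|[|n]]]]] ltn] // _.
  + by rewrite -(y_pow 0); congr (y@_(f _)); apply: val_inj.
  + by rewrite -(y_pow 1); congr (y@_(f _)); apply: val_inj.
  + by rewrite -(y_pow 3); congr (y@_(f _)); apply: val_inj.
  + by rewrite -(y_pow 2); congr (y@_(f _)); apply: val_inj.
have -> : y = (y@_(f 0) - alpha * y@_(f 1)) *: axis + y@_(f 1) *: axis0.
  apply: coordP => k; rewrite mcoeffD !mcoeffZ coord_axis0 coordU eq_sym.
  case: eqP => [->|/eqP/yk->]; rewrite ?mulr1n ?mulr0n; ring.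
apply: eigensumD.
  apply: eigensum_eigenset (eigensetZ _ eigenset_axis).
  by rewrite !inE eqxx.
apply: eigensum_eigenset (eigensetZ _ eigenset_axis0).
by rewrite !inE eqxx orbT.
Qed.

(** On vectors fixed by - 1 = 2 ^ 2, the dilation by 2 is an involution: split
into its symmetric and antisymmetric parts. *)
Lemma dilN1_eigensum y : dil_eigen (- 1) 1 y ->
  eigensum L [fset 1; 0; alpha]%fset y.
Proof.
move=> yN; have y4 k : y@_(f (2%:R * (2%:R * k))) = y@_(f k).
  rewrite mulrA -[RHS]mul1r -yN; congr (y@_(f (_ * _))).
  exact: val_inj.
pose part (s : F) := vec (fun k => (y@_(f k) + s * y@_(f (2%:R * k))) / 2%:R).
have -> : y = part 1 + part (- 1).
  by apply: coordP => k; rewrite mcoeffD !coord_vec; field.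
have partP s : s * s = 1 -> dil_eigen 2%:R s (part s).
  move=> ss i; rewrite !coord_vec y4 mulrA; congr (_ / _).
  by rewrite mulrDr mulrA ss mul1r addrC.
apply: eigensumD.
  apply: (@eigensum_sub _ _ _ _ [fset 1; 0]%fset); first exact: fsubsetUl.
  by apply/dil2_eigensum/partP; rewrite mulr1.
apply: (@eigensum_eigenset _ _ _ _ _ alpha); first by rewrite !inE eqxx !orbT.
by apply/dil_eigenset_alpha/partP; rewrite mulrNN mulr1.
Qed.

(** Split into the symmetric and antisymmetric parts under - 1. *)
Lemma eigensum_full y : eigensum L (monster_set alpha (- alpha)) y.
Proof.
pose part (s : F) := vec (fun k => (y@_(f k) + s * y@_(f (- k))) / 2%:R).
have -> : y = part 1 + part (- 1).
  by apply: coordP => k; rewrite mcoeffD !coord_vec; field.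
have partP s : s * s = 1 -> dil_eigen (- 1) s (part s).
  move=> ss i; rewrite !coord_vec mulN1r opprK mulrA; congr (_ / _).
  by rewrite mulrDr mulrA ss mul1r addrC.
apply: eigensumD.
  apply: (@eigensum_sub _ _ _ _ [fset 1; 0; alpha]%fset).
    exact: fsubsetUl.
  by apply/dilN1_eigensum/partP; rewrite mulr1.
apply: (@eigensum_eigenset _ _ _ _ _ (- alpha)).
  by rewrite !inE eqxx !orbT.
by apply/dil_eigenset_beta/partP; rewrite mulrNN mulr1.
Qed.

(** Summing the third equation over the nonzero labels gives the first, as the
coefficient 4 eta + alpha = 1 + 3 eta of tail y vanishes. *)
Lemma eigenset_coord lambda y : eigenset L lambda y ->
  [/\ lambda * tail y = 0, lambda * y@_(f 0) = eta * tail y + y@_(f 0)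
    & forall k, k != 0 ->
        lambda * y@_(f k) = eta * tail y + alpha * y@_(f (- k))].
Proof.
move=> ay; have coord k : lambda * y@_(f k) =
    eta * tail y + alpha * y@_(f (- k)) + eta * ((k == 0)%:R * y@_(f 0)).
  by rewrite -mcoeffZ -ay coord_axis_mul.
have coord0 : lambda * y@_(f 0) = eta * tail y + y@_(f 0).
  by rewrite coord oppr0 eqxx mulr1n; ring.
split=> // [|k k0]; last by rewrite coord (negPf k0) mulr0n mul0r mulr0 addr0.
rewrite mulrBr coord0 mulr_sumr (eq_bigr _ (fun k _ => coord k)) !big_split /=.
have -> : \sum_k alpha * y@_(f (- k)) = alpha * \sum_k y@_(f k).
  by rewrite -mulr_sumr [in RHS](reindex_inj oppr_inj).
have -> : \sum_(k : 'F_5) eta * ((k == 0)%:R * y@_(f 0)) = eta * y@_(f 0).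
  apply: etrans (sum_delta (fun=> eta * y@_(f 0)) 0).
  by apply: eq_bigr => k _; rewrite mulrCA mulrC.
rewrite sumr_const card_Fp //; set t := tail y.
transitivity ((1 + 3%:R * eta) * t); first by rewrite -mulr_natr /t; ring.
by rewrite eta3 mul0r.
Qed.

(** Applying the coordinate equation at k and - k yields alpha ^ 2 y_k = y_k,
where 1 - alpha ^ 2 = eta (1 + alpha). *)
Lemma eigenset_one y : eigenset L 1 y -> y = y@_(f 0) *: axis.
Proof.
move=> /eigenset_coord[]; rewrite mul1r => t0 _ yk.
have yN k : k != 0 -> y@_(f k) = alpha * y@_(f (- k)).
  by move=> k0; rewrite -[LHS]mul1r yk // t0 mulr0 add0r.
apply: coordP => k; rewrite mcoeffZ coordU eq_sym.
have [->|k0] := eqVneq k 0; first by rewrite mulr1.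
rewrite mulr0n mulr0; apply/eqP.
have : eta * (1 + alpha) * y@_(f k) == 0.
  have aNk := yN (- k); rewrite oppr_eq0 opprK in aNk.
  have -> : eta * (1 + alpha) * y@_(f k)
      = y@_(f k) - alpha * (alpha * y@_(f k)) by ring.
  by rewrite -aNk // -yN // subrr.
by rewrite !mulf_eq0 (negPf eta_neq0) (negPf alpha_neqN1).
Qed.

Lemma eigenset_zero y : eigenset L 0 y ->
  y = (y@_(f 0) / alpha) *: axis0.
Proof.
move=> /eigenset_coord[_]; rewrite mul0r => /eqP.
rewrite eq_sym addrC addr_eq0 => /eqP y0 yk.
apply: coordP => k; rewrite mcoeffZ coord_axis0.
have [->|k0] := eqVneq k 0; first by rewrite mulr1 divfK // alpha_neq0.
rewrite mulr0n mulr0 subr0 mulr1; apply: (canRL (mulfK alpha_neq0)).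
have := yk (- k); rewrite oppr_eq0 mul0r opprK => /(_ k0)/eqP.
by rewrite eq_sym addrC addr_eq0 mulrC -y0 => /eqP.
Qed.

Lemma eigenset_neq01 lambda y : lambda != 0 -> lambda != 1 ->
    eigenset L lambda y ->
  [/\ tail y = 0, y@_(f 0) = 0
    & forall k, lambda * y@_(f k) = alpha * y@_(f (- k))].
Proof.
move=> l0 l1 /eigenset_coord[/eqP + + yk].
rewrite mulf_eq0 (negPf l0) => /eqP t0; rewrite t0 mulr0 add0r => /eqP.
rewrite -subr_eq0 -{2}[y@_(f 0)]mul1r -mulrBl mulf_eq0 subr_eq0 (negPf l1).
move=> /eqP y0; split=> // k; have [->|k0] := eqVneq k 0.
  by rewrite oppr0 y0 !mulr0.
by rewrite yk // t0 mulr0 add0r.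
Qed.

Lemma eigenset_alpha_dil y : eigenset L alpha y -> dil_eigen 2%:R (- 1) y.
Proof.
move=> /(eigenset_neq01 alpha_neq0 alpha_neq1)[t0 y0 yk].
have yN k : y@_(f (- k)) = y@_(f k) by apply/esym/(mulfI alpha_neq0).
move=> k; rewrite mulN1r; have [->|k0] := eqVneq k 0.
  by rewrite mulr0 y0 oppr0.
have := tailE y k0; rewrite t0 mulrN !yN => /eqP.
rewrite eq_sym (_ : _ + _ = 2%:R * (y@_(f (2%:R * k)) + y@_(f k))); last ring.
by rewrite mulf_eq0 (negPf two_neq0) addr_eq0 => /eqP.
Qed.

Lemma eigenset_beta_dil y : eigenset L (- alpha) y -> dil_eigen (- 1) (- 1) y.
Proof.
have Na0 : - alpha != 0 by rewrite oppr_eq0 alpha_neq0.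
move=> /(eigenset_neq01 Na0 Nalpha_neq1)[_ _ yk] k.
by apply: (mulfI alpha_neq0); rewrite !mulN1r -yk mulrN mulNr.
Qed.

Hypothesis alpha4 : alpha ^+ 4 != 1.

(** Going four times through k |-> 2 k multiplies a coordinate by alpha ^ 4 and
returns to the same label. *)
Lemma right_eigenset_one y : eigenset (alg_mul eta ^~ axis) 1 y ->
  y = y@_(f 0) *: axis.
Proof.
rewrite /eigenset /= scale1r => ya.
have t0 : tail y = 0.
  apply/eqP; have := coord_mul_axis y 0; rewrite mulr0 ya eqxx mulr1n => /eqP.
  rewrite -subr_eq0 (_ : _ - _ = - (eta * tail y)); last by ring.
  by rewrite oppr_eq0 mulf_eq0 (negPf eta_neq0).
have y2 k : k != 0 -> y@_(f (2%:R * k)) = alpha * y@_(f k).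
  move=> k0; rewrite -{1}ya coord_mul_axis t0 (negPf k0).
  by rewrite mulr0 add0r mulr0n mul0r mulr0 addr0.
apply: coordP => k; rewrite mcoeffZ coordU eq_sym.
have [->|k0] := eqVneq k 0; first by rewrite mulr1.
rewrite mulr0n mulr0; apply/eqP; have : (1 - alpha ^+ 4) * y@_(f k) == 0.
  have k16 : 2%:R * (2%:R * (2%:R * (2%:R * k))) = k.
    by rewrite !mulrA -[RHS]mul1r; congr (_ * _); apply: val_inj.
  rewrite mulrBl mul1r -{1}k16 !y2 ?mulf_neq0 // subr_eq0; apply/eqP; ring.
by rewrite mulf_eq0 subr_eq0 eq_sym (negPf alpha4).
Qed.

Lemma axis_neq0 : axis != 0.
Proof.
apply/eqP => /(congr1 (mcoeff (f 0))) /eqP.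
by rewrite coordU eqxx mcoeff0 oner_eq0.
Qed.

Lemma primitive_axis : primitive (alg_mul eta) axis.
Proof.
split; apply: (has_dim1 axis_neq0).
- exact: eigenset_axis.
- by move=> y /eigenset_one ->; exists (y@_(f 0)).
- by rewrite /eigenset /= axis_mul_axis scale1r.
- by move=> y /right_eigenset_one ->; exists (y@_(f 0)).
Qed.

(** * The fusion law *)

Lemma dil2_fixed nu z : nu \in [:: 1; 0] ->
  eigenset L nu z -> dil_eigen 2%:R 1 z.
Proof.
rewrite !inE => /orP[/eqP->/eigenset_one->|/eqP->/eigenset_zero->].
- exact/dil_eigenZ/dil_eigen_axis.
- exact/dil_eigenZ/dil_eigen_axis0.
Qed.

Lemma dilN1_fixed nu z : nu \in [:: 1; 0; alpha] ->
  eigenset L nu z -> dil_eigen (- 1) 1 z.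
Proof.
rewrite -[[:: 1; 0; alpha]]/([:: 1; 0] ++ [:: alpha]) mem_cat.
case/orP=> [nu01 /(dil2_fixed nu01)/dil_eigen_sqr|]; first by rewrite mulr1.
rewrite inE => /eqP-> /eigenset_alpha_dil/dil_eigen_sqr.
by rewrite mulrNN mulr1.
Qed.

Lemma alg_mulZZ c d x y :
  alg_mul eta (c *: x) (d *: y) = (c * d) *: alg_mul eta x y.
Proof. by rewrite linearZl_LR linearZr_LR /= scalerA. Qed.

Lemma axis_fusion lambda mu x y :
    lambda \in monster_set alpha (- alpha) ->
    mu \in monster_set alpha (- alpha) ->
    eigenset L lambda x -> eigenset L mu y ->
  eigensum L (monster_op alpha (- alpha) lambda mu)
    (alg_mul eta x y).
Proof.
move=> lM mM xl ym.
have two0 : 2%:R != 0 :> 'F_5 by [].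
have N1 : - 1 != 0 :> 'F_5 by [].
have in_beta z : dil_eigen (- 1) (- 1) z ->
    eigensum L [fset - alpha]%fset z.
  by move=> /dil_eigenset_beta; apply: eigensum_eigenset; rewrite inE.
have in_alpha z : dil_eigen 2%:R (- 1) z ->
    eigensum L [fset alpha]%fset z.
  by move=> /dil_eigenset_alpha; apply: eigensum_eigenset; rewrite inE.
have even_odd nu u v : nu \in [:: 1; 0; alpha] ->
    eigenset L nu u -> eigenset L (- alpha) v ->
    eigensum L [fset - alpha]%fset (alg_mul eta u v).
  move=> nuE /(dilN1_fixed nuE) uN /eigenset_beta_dil vN; apply: in_beta.
  by have := dil_eigen_mul N1 uN vN; rewrite mul1r.
have odd_even nu u v : nu \in [:: 1; 0; alpha] ->
    eigenset L (- alpha) u -> eigenset L nu v ->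
    eigensum L [fset - alpha]%fset (alg_mul eta u v).
  move=> nuE /eigenset_beta_dil uN /(dilN1_fixed nuE) vN; apply: in_beta.
  by have := dil_eigen_mul N1 uN vN; rewrite mulr1.
have fixed_alpha nu u v : nu \in [:: 1; 0] ->
    eigenset L nu u -> eigenset L alpha v ->
    eigensum L [fset alpha]%fset (alg_mul eta u v).
  move=> nuE /(dil2_fixed nuE) u2 /eigenset_alpha_dil v2; apply: in_alpha.
  by have := dil_eigen_mul two0 u2 v2; rewrite mul1r.
have alpha_fixed nu u v : nu \in [:: 1; 0] ->
    eigenset L alpha u -> eigenset L nu v ->
    eigensum L [fset alpha]%fset (alg_mul eta u v).
  move=> nuE /eigenset_alpha_dil u2 /(dil2_fixed nuE) v2; apply: in_alpha.
  by have := dil_eigen_mul two0 u2 v2; rewrite mulr1.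
move: good_eigenvalues; rewrite /= !inE !negb_or => /and4P[].
move=> /and3P[n10 n1a n1b] /andP[n0a n0b] nab _.
have neqs : ((0 == 1 :> F) = false) * ((1 == 0 :> F) = false) *
    ((alpha == 1) = false) * ((- alpha == 1) = false) *
    ((alpha == 0) = false) * ((- alpha == 0) = false) *
    ((- alpha == alpha) = false) * ((alpha == - alpha) = false).
  by do !split; apply/negbTE; rewrite // eq_sym.
rewrite /monster_op; move: lM mM; rewrite !inE -!orbA.
case/or4P=> /eqP El; case/or4P=> /eqP Em;
  rewrite {}El in xl *; rewrite {}Em in ym *; rewrite ?eqxx ?neqs /=.
- rewrite (eigenset_one xl) (eigenset_one ym) alg_mulZZ axis_mul_axis.
  by apply: eigensum_eigenset (eigensetZ _ eigenset_axis); rewrite inE.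
- rewrite (eigenset_one xl) (eigenset_zero ym) alg_mulZZ axis_mul_axis0 scaler0.
  exact: eigensum0.
- by apply: (fixed_alpha 1); rewrite // !inE eqxx.
- by apply: (even_odd 1); rewrite // !inE eqxx.
- rewrite (eigenset_zero xl) (eigenset_one ym) alg_mulZZ axis0_mul_axis scaler0.
  exact: eigensum0.
- rewrite (eigenset_zero xl) (eigenset_zero ym) alg_mulZZ axis0_mul_axis0.
  rewrite scalerA.
  by apply: eigensum_eigenset (eigensetZ _ eigenset_axis0); rewrite inE.
- by apply: (fixed_alpha 0); rewrite // !inE eqxx orbT.
- by apply: (even_odd 0); rewrite // !inE eqxx orbT.
- by apply: (alpha_fixed 1); rewrite // !inE eqxx.
- by apply: (alpha_fixed 0); rewrite // !inE eqxx orbT.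
- apply: dil2_eigensum.
  have := dil_eigen_mul two0 (eigenset_alpha_dil xl) (eigenset_alpha_dil ym).
  by rewrite mulrNN mulr1.
- by apply: (even_odd alpha); rewrite // !inE eqxx !orbT.
- by apply: (odd_even 1); rewrite // !inE eqxx.
- by apply: (odd_even 0); rewrite // !inE eqxx orbT.
- by apply: (odd_even alpha); rewrite // !inE eqxx !orbT.
- apply: dilN1_eigensum.
  have := dil_eigen_mul N1 (eigenset_beta_dil xl) (eigenset_beta_dil ym).
  by rewrite mulrNN mulr1.
Qed.

Lemma pentagon_left_axis :
  left_axis (alg_mul eta) (monster_law alpha (- alpha)) axis.
Proof.
split.
- exact: axis_mul_axis.
- exact: primitive_axis.
- by apply/seteqP; split=> // y _; apply: eigensum_full.
- exact: axis_fusion.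
Qed.

End Axis.
End Pentagon.

Theorem proposition1 (X : oddTranspositionGroup) (F : fieldType) (eta : F)
    (X_two_generated : two_generated X) (X_GM5 : GM_type X 5)
    (char_not2 : 2%N \notin [pchar F]) (char_not5 : 5%N \notin [pchar F])
    (etaE : eta = - (1 / 3)) (F_good : good_char 5 eta) :
  forall t : ot_set X,
    left_axis (alg_mul eta) (monster_law (4 / 3) (- (4 / 3)))
      (<< t >> : {malg F[ot_set X]}).
Proof.
move=> t.
have [f [<- f_bij f_conj f_inv]] := pentagon_labelling t X_two_generated X_GM5.
have two_neq0 : 2%:R != 0 :> F.
  by apply: contra char_not2 => two0; rewrite inE two0.
have five_neq0 : 5%:R != 0 :> F.
  by apply: contra char_not5 => five0; rewrite inE five0.
have three_neq0 : 3%:R != 0 :> F.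
  (* inverses of 0 are 0, so 3 = 0 would give eta = 0 and eta (5 - 2) + 1 = 1 *)
  apply/eqP => three0; move: F_good.
  by rewrite /good_char etaE three0 invr0 mulr0 oppr0 mul0r add0r /= inE eqxx.
have alphaE : 4 / 3 = 1 - eta by rewrite etaE; field.
have good : uniq [:: 1; 0; 1 - eta; - (1 - eta)].
  (* with eta = - 1 / 3, these are the four values of good characteristic *)
  have -> : 0 = eta * (5%:R - 2) + 1 by rewrite etaE; field.
  rewrite opprB; move: F_good; congr is_true; apply: perm_uniq.
  by rewrite !perm_cons (perm_catC [:: _] [:: _]).
(* 7 = 0 would give 4 / 3 = - 1, and then - (4 / 3) = 1 *)
have seven_neq0 : 7%:R != 0 :> F.
  apply/eqP => seven0; move: good; rewrite -alphaE /= !inE !negb_or.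
  case/andP=> /and3P[_ _ /eqP neq] _; apply: neq.
  apply: (mulIf three_neq0); apply/eqP; rewrite -subr_eq0.
  by rewrite -seven0; apply/eqP; field.
rewrite alphaE; apply: pentagon_left_axis => //.
- by rewrite etaE; field.
- have : (1 - eta) ^+ 4 - 1 = 5%:R ^+ 2 * 7%:R / 3%:R ^+ 4.
    rewrite etaE; field; rewrite three_neq0 andbT.
    by rewrite (_ : 81 = 3%:R ^+ 4) ?expf_neq0 //; ring.
  move=> diffE; rewrite -subr_eq0 diffE.
  by rewrite !mulf_neq0 ?invr_eq0 ?expf_neq0.
Qed.
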